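(* Let $X_x$ be a Toeplitz system and let $P\in\mathbb{Z}[X]$ be a permutation modulo each essential period of $X_x$. Then $(\sigma^{P(n)}y)_{n\ge1}$ is dense in $X_x$ for any $y\in X_x$.
   Context: Let $\sigma$ be the left shift on $\{0,1\}^{\mathbb{Z}}$ (product topology), $(\sigma y)(i)=y(i+1)$. A word $x\in\{0,1\}^{\mathbb{Z}}$ is called a Toeplitz word if for every $a\in\mathbb{Z}$ there exists $\ell\in\mathbb{Z}^+$ such that $x(a)=x(a+j\ell)$ for all $j\in\mathbb{Z}$. The Toeplitz system $X_x$ is the orbit closure $\overline{\{\sigma^n x:n\in\mathbb{Z}\}}$ in $\{0,1\}^{\mathbb{Z}}$ with the action of $\sigma$; it is minimal. For $s\in\mathbb{Z}^+$ let $\mathrm{Per}_s(x)=\{a\in\mathbb{Z}: x(a)=x(a+js)\text{ for all }j\in\mathbb{Z}\}$. An essential period of a Toeplitz word $x$ is a positive integer $s$ such that $\mathrm{Per}_s(x)$ is nonempty and $\mathrm{Per}_s(x)\neq\mathrm{Per}_{s'}(x)$ for every positive integer $s'<s$. All Toeplitz words in $X_x$ have the same essential periods, and these are called the essential periods of the Toeplitz system $X_x$. A polynomial $P\in\mathbb{Z}[X]$ is a permutation modulo $n$ if the induced map $P:\mathbb{Z}/n\mathbb{Z}\to\mathbb{Z}/n\mathbb{Z}$ is a bijection. *)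

(* Defs.v *)
From HB Require Import structures.
From mathcomp Require Import all_boot all_order all_algebra.
From mathcomp Require Import all_classical all_reals all_analysis.

Set Implicit Arguments.
Unset Strict Implicit.
Unset Printing Implicit Defensive.

Import Order.TTheory GRing.Theory Num.Theory.

Local Open Scope classical_set_scope.
Local Open Scope ring_scope.

Notation word := (prod_topology (fun _ : int => bool)).

Definition shift (y : word) : word := fun i : int => y (i + 1).

Definition shift_inv (y : word) : word := fun i : int => y (i - 1).

Lemma shiftK : cancel shift shift_inv.
Proof. by move=> y; apply/funext => i; rewrite /shift_inv /shift subrK. Qed.

Lemma shift_invK : cancel shift_inv shift.
Proof. by move=> y; apply/funext => i; rewrite /shift_inv /shift addrK. Qed.

Definition shiftz (m : int) (y : word) : word :=
  match m with
  | Posz n => iter n shift y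
  | Negz n => iter n.+1 shift_inv y
  end.

Lemma shiftzE (m : int) (y : word) (i : int) : shiftz m y i = y (i + m).
Proof.
have shiftE z j : shift z j = z (j + 1) by [].
have shift_invE z j : shift_inv z j = z (j - 1) by [].
case: m => n; rewrite ?NegzE /=.
  elim: n i => [|n IHn] i; first by rewrite /= addr0.
  by rewrite /= shiftE IHn -addrA -PoszD add1n.
elim: n i => [//|n IHn] i.
by rewrite /= shift_invE IHn -addrA -opprD -PoszD add1n.
Qed.

Definition toeplitz (x : word) : Prop :=
  forall a : int, exists l : nat,
    (0 < l)%N /\ forall j : int, x a = x (a + j * l%:Z).

Definition orbit_closure (x : word) : set word :=
  closure [set shiftz n x | n in [set: int]].

Definition Per (s : nat) (x : word) : set int :=
  [set a | forall j : int, x a = x (a + j * s%:Z)].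

(* All Toeplitz words in orbit_closure x have the same essential periods, so
   for x Toeplitz these are the essential periods of the system
   orbit_closure x. *)
Definition essential_period (x : word) (s : nat) : Prop :=
  [/\ (0 < s)%N, Per s x !=set0
    & forall s' : nat, (0 < s')%N -> (s' < s)%N -> Per s x <> Per s' x].

(* Z/nZ is represented by 'I_n, which unlike 'Z_n also covers n = 1; the
   default value of insubd is never used, see val_induced_map. *)
Definition induced_map (P : {poly int}) (n : nat) (i : 'I_n) : 'I_n :=
  insubd i `|(P.[(i : nat)%:Z] %% n%:Z)%Z|%N.

Lemma val_induced_map (P : {poly int}) (n : nat) (i : 'I_n) :
  (induced_map P i : nat)%:Z = (P.[(i : nat)%:Z] %% n%:Z)%Z.
Proof.
have n_gt0 : (0 < n)%N by apply: leq_ltn_trans (ltn_ord i).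
have r_ge0 : 0 <= (P.[(i : nat)%:Z] %% n%:Z)%Z.
  by apply: modz_ge0; rewrite -lt0n.
rewrite val_insubd ifT; first exact: gez0_abs.
by rewrite -ltz_nat gez0_abs // ltz_pmod.
Qed.

Definition permutation_mod (P : {poly int}) (n : nat) : Prop :=
  bijective (@induced_map P n).

Definition dense_in (X S : set word) : Prop :=
  S `<=` X /\ X `<=` closure S.

(* Main.v *)
Require Import Defs.
From HB Require Import structures.
From mathcomp Require Import all_boot all_order all_algebra.
From mathcomp Require Import all_classical all_reals all_analysis.
From mathcomp Require Import ring.

(** Since [y] is a limit of translates of [x], compactness gives, for each
    [s > 0], a single residue [r] modulo [s] such that [y] is a limit of
    translates of [x] by integers congruent to [r]; then [y i = x (i + r)]
    whenever [i + r] lies in [Per s x]. To approximate a translate [x (. + m)]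
    on a finite window, take an essential period [s] such that [Per s x]
    contains the window shifted by [m], and [n >= 1] with [P(n) + r] congruent
    to [m] modulo [s]: then [shiftz P(n) y] agrees with [x (. + m)] there. *)

Set Implicit Arguments.
Unset Strict Implicit.
Unset Printing Implicit Defensive.

Import Order.TTheory GRing.Theory Num.Theory.

Local Open Scope classical_set_scope.
Local Open Scope ring_scope.

Lemma nbhs_cylinder (y : word) (t : seq int) :
  nbhs y [set z : word | {in t, z =1 y}].
Proof.
elim: t => [|a t IHt]; first by apply: filterS filterT => z _ i.
have a_nbhs : nbhs y [set z : word | z a = y a].
  exact: (@proj_continuous _ (fun _ : int => bool) a y) (discrete_set1 (y a)).
apply: filterS (filterI a_nbhs IHt) => z [za zt] i.
by rewrite inE => /predU1P[->|/zt].
Qed.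

(** Words agreeing with [y] on a finite window form a neighbourhood base at [y], so membership in a
    closure becomes a question about finite patterns. *)
Lemma closure_wordP (S : set word) (y : word) :
  closure S y <->
  forall t : seq int, exists2 z : word, S z & {in t, z =1 y}.
Proof.
split=> [Sy t|S_dense].
  by have [z [Sz zt]] := Sy _ (nbhs_cylinder y t); exists z.
(* [F] is generated by the traces on [S] of the cylinders around [y]; the hypothesis makes it
   proper. *)
pose F := filter_from [set: seq int]
  (fun t => [set z : word | S z /\ {in t, z =1 y}]).
have F_filter : ProperFilter F.
  apply: filter_from_proper => [|t _]; last first.
    by have [z Sz zt] := S_dense t; exists z.
  apply: filter_from_filter; first by exists [::].
  move=> t u _ _; exists (t ++ u) => // z [Sz ztu].
  by split; split=> // i it; apply: ztu; rewrite mem_cat it ?orbT.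
rewrite closureEcvg; exists F => //; split; last first.
  by move=> A /= SA; exists [::] => // z [/SA].
(* Convergence is tested one coordinate at a time; constant words show that each projection is
   surjective. *)
apply/cvg_sup => a; apply/cvg_image.
  rewrite -subTset => b _; exists (fun _ : int => b) => //.
move=> A /= /nbhs_singleton Aya.
exists [set z : word | A (z a)]; last first.
  rewrite eqEsubset; split=> [_ [z Az <-] //|b Ab].
  by exists (fun _ : int => b).
exists [:: a] => // z [_ za] /=.
by rewrite za ?inE.
Qed.

Lemma orbit_closureP (x y : word) :
  orbit_closure x y <->
  forall t : seq int, exists k : int, {in t, forall i, y i = x (i + k)}.
Proof.
split=> [/closure_wordP xy t|xy].
  have [_ [k _ <-] kt] := xy t; exists k => i /kt.
  by rewrite shiftzE => ->.
apply/closure_wordP => t; have [k kt] := xy t.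
by exists (shiftz k x) => [|i /kt ->]; [exists k|rewrite shiftzE].
Qed.

Lemma orbit_closure_shiftz (x y : word) (m : int) :
  orbit_closure x y -> orbit_closure x (shiftz m y).
Proof.
move=> /orbit_closureP xy; apply/orbit_closureP => t.
have [k kt] := xy [seq i + m | i <- t]; exists (m + k) => i it.
by rewrite shiftzE kt ?addrA //; apply: (map_f (fun j => j + m)).
Qed.

Lemma orbit_closure_residue (x y : word) (s : nat) : (0 < s)%N ->
  orbit_closure x y ->
  exists r : int, forall t : seq int, exists2 k : int,
    (s%:Z %| k - r)%Z & {in t, forall i, y i = x (i + k)}.
Proof.
move=> s_gt0 /orbit_closureP xy; apply: contrapT => no_r.
(* If every residue fails on some finite window, all fail on their union. *)
have bad (r : 'I_s) : exists t : seq int, forall k : int,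
    (s%:Z %| k - (r : nat)%:Z)%Z -> ~ {in t, forall i, y i = x (i + k)}.
  apply: contrapT => r_good; apply: no_r; exists (r : nat)%:Z => t.
  apply: contrapT => t_bad; apply: r_good; exists t => k kr kt.
  by apply: t_bad; exists k.
have [f f_bad] := choice bad.
have [k kt] := xy (flatten [seq f r | r <- enum 'I_s]).
have k_lt : (`|(k %% s)%Z| < s)%N.
  by rewrite -ltz_nat gez0_abs ?ltz_pmod ?modz_ge0 // -lt0n.
pose r := Ordinal k_lt.
apply: (f_bad r k) => [|i ir].
  rewrite /= gez0_abs ?modz_ge0 -?lt0n //.
  by rewrite {1}(divz_eq k s) addrK dvdz_mull.
apply: kt; apply/flattenP; exists (f r) => //.
by rewrite map_f ?mem_enum.
Qed.

Lemma Per_dvd (x : word) (s l : nat) : (s %| l)%N -> Per s x `<=` Per l x.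
Proof.
move=> /dvdnP[q ->] a sa j.
by rewrite PoszM mulrA; apply: sa.
Qed.

Lemma toeplitz_common_period (x : word) (t : seq int) : toeplitz x ->
  exists2 l : nat, (0 < l)%N & {in t, forall a, Per l x a}.
Proof.
move=> xT; elim: t => [|a t [l l_gt0 lt]]; first by exists 1%N.
have [k [k_gt0 ka]] := xT a.
exists (k * l)%N => [|b]; first by rewrite muln_gt0 k_gt0.
rewrite inE => /predU1P[->|/lt lb].
  by apply: Per_dvd ka; apply: dvdn_mulr.
by apply: Per_dvd lb; apply: dvdn_mull.
Qed.

(** The least positive [s] with the same [Per] set as [l] is essential: a smaller [s'] with that set
    would contradict minimality. *)
Lemma essential_period_exists (x : word) (l : nat) : (0 < l)%N ->
  Per l x !=set0 -> exists2 s : nat, essential_period x s & Per s x = Per l x.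
Proof.
move=> l_gt0 l_neq0.
have ex_s : exists s, (0 < s)%N && `[< Per s x = Per l x >].
  by exists l; rewrite l_gt0; apply/asboolP.
case: (ex_minnP ex_s) => s /andP[s_gt0 /asboolP sl] s_min.
exists s => //; split=> // [|s' s'_gt0 s's ss']; first by rewrite sl.
have := s_min s'; rewrite s'_gt0 leqNgt s's /=.
by move=> H; have := H (introT (asboolP _) (etrans (esym ss') sl)).
Qed.

Lemma essential_period_window (x : word) (t : seq int) : toeplitz x ->
  exists2 s : nat, essential_period x s & {in t, forall a, Per s x a}.
Proof.
(* Adding [0] to the window keeps [Per l x] nonempty even when [t] is empty. *)
move=> xT; have [l l_gt0 lt] := toeplitz_common_period (0 :: t) xT.
have [|s s_ess sl] := @essential_period_exists x l l_gt0.
  by exists 0; apply: lt; rewrite mem_head.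
exists s => // a ta; rewrite sl; apply: lt.
by rewrite inE ta orbT.
Qed.

(** By the factor theorem, ['X - b] divides [P - P(b)]; evaluate at [a]. *)
Lemma dvdz_horner_sub (P : {poly int}) (a b : int) :
  (a - b %| P.[a] - P.[b])%Z.
Proof.
have /factor_theorem[q Pq] : root (P - P.[b]%:P) b.
  by rewrite /root !hornerE subrr.
have : (P - P.[b]%:P).[a] = (q * ('X - b%:P)).[a] by rewrite Pq.
by rewrite !hornerE => ->; apply: dvdz_mull.
Qed.

Lemma permutation_mod_surj (P : {poly int}) (s : nat) (c : int) :
  (0 < s)%N -> permutation_mod P s ->
  exists2 n : nat, (1 <= n)%N & (s%:Z %| c - P.[n%:Z])%Z.
Proof.
move=> s_gt0 [g _ gK].
have c_lt : (`|(c %% s)%Z| < s)%N.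
  by rewrite -ltz_nat gez0_abs ?ltz_pmod ?modz_ge0 // -lt0n.
pose i := g (Ordinal c_lt).
have Pi : (P.[(i : nat)%:Z] %% s)%Z = (c %% s)%Z.
  by rewrite -val_induced_map gK /= gez0_abs ?modz_ge0 // -lt0n.
(* The preimage [i] may be [0]; adding [s] makes it positive and keeps the residue of [P] modulo
   [s]. *)
exists (i + s)%N; first by rewrite addn_gt0 s_gt0 orbT.
have -> : c - P.[(i + s)%N%:Z] =
    (c - P.[(i : nat)%:Z]) - (P.[(i + s)%N%:Z] - P.[(i : nat)%:Z]) by ring.
apply: rpredB; first by rewrite -eqz_mod_dvd Pi.
by apply: dvdz_trans (dvdz_horner_sub _ _ _); rewrite PoszD addrAC subrr add0r.
Qed.

Theorem theorem5p5 (x : word) (P : {poly int}) (x_toeplitz : toeplitz x)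
    (P_perm : forall s : nat, essential_period x s -> permutation_mod P s)
    (y : word) (y_in : orbit_closure x y) :
  dense_in (orbit_closure x)
    [set shiftz P.[n%:Z] y | n in [set n : nat | (1 <= n)%N]].
Proof.
split=> [_ [n _ <-]|z /orbit_closureP xz]; first exact: orbit_closure_shiftz.
apply/closure_wordP => t; have [m zm] := xz t.
have [s s_ess s_t] := essential_period_window [seq i + m | i <- t] x_toeplitz.
have [s_gt0 _ _] := s_ess.
have [r yr] := orbit_closure_residue s_gt0 y_in.
have [n n_ge1 nP] := permutation_mod_surj (m - r) s_gt0 (P_perm s s_ess).
exists (shiftz P.[n%:Z] y) => [|i it]; first by exists n.
(* A one-point window suffices: [r], and hence [n], was fixed before [i], and only [k] varies with
   [i]. *)
have [k kr yk] := yr [:: i + P.[n%:Z]].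
rewrite shiftzE yk ?mem_head // zm //.
(* The residue [r] cancels: [P(n) + k] is congruent to [m] modulo [s], and [i + m] lies in
   [Per s x]. *)
have /dvdzP[j jE] : (s%:Z %| (k - r) - (m - r - P.[n%:Z]))%Z by apply: rpredB.
rewrite (s_t _ (map_f (fun i => i + m) it) j) -jE.
by congr x; ring.
Qed.
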